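(* Consider the average transmission energy minimization problem (for a given encoding rate $D\in\{D_1,\ldots,D_L\}$) $$\min_{\mathbf t,\mathbf p}\ \sum_{(\mathbf x,\mathbf h)\in\mathcal X^K\times\mathcal H^K}\Pr[(\mathbf X,\mathbf H)=(\mathbf x,\mathbf h)]\sum_{i\in\mathcal I(\mathbf x)}t_i(\mathbf x,\mathbf h)\,p_i(\mathbf x,\mathbf h)$$ over real families $\mathbf t=(t_i(\mathbf X,\mathbf H))$ and $\mathbf p=(p_i(\mathbf X,\mathbf H))$ with $p_i(\mathbf X,\mathbf H)\ge 0$, indexed by $\mathbf X\in\mathcal X^K$, $\mathbf H\in\mathcal H^K$, $i\in\mathcal I(\mathbf X)$, subject to, for all $\mathbf X\in\mathcal X^K$ and $\mathbf H=(H_k)_{k\in\mathcal K}\in\mathcal H^K$: $$t_i(\mathbf X,\mathbf H)\ge 0\ \ (i\in\mathcal I(\mathbf X)),\qquad \sum_{i\in\mathcal I(\mathbf X)}t_i(\mathbf X,\mathbf H)\le T,$$ $$t_i(\mathbf X,\mathbf H)\,B\log_2\!\left(1+\frac{p_i(\mathbf X,\mathbf H)H_k}{n_0}\right)\ge S_i(\mathbf X)DT\quad (k\in\mathcal K_i(\mathbf X),\ i\in\mathcal I(\mathbf X)).$$ An optimal solution $(\mathbf t_{\mathrm e}^\star,\mathbf p_{\mathrm e}^\star)$ of this problem is given, for all $\mathbf X\in\mathcal X^K$, $\mathbf H\in\mathcal H^K$, $i\in\mathcal I(\mathbf X)$, by $$t_{\mathrm e,i}^\star(\mathbf X,\mathbf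 H)=\frac{S_i(\mathbf X)DT\ln 2}{B\left(W\!\left(\frac{\lambda^\star(\mathbf X,\mathbf H)H_{i,\min}(\mathbf X,\mathbf H)}{n_0e}-\frac1e\right)+1\right)},$$ $$p_{\mathrm e,i}^\star(\mathbf X,\mathbf H)=\frac{n_0\left(e^{W\left(\frac{\lambda^\star(\mathbf X,\mathbf H)H_{i,\min}(\mathbf X,\mathbf H)}{n_0e}-\frac1e\right)+1}-1\right)}{H_{i,\min}(\mathbf X,\mathbf H)},$$ where, for each $(\mathbf X,\mathbf H)\in\mathcal X^K\times\mathcal H^K$, $\lambda^\star(\mathbf X,\mathbf H)>0$ (the Lagrange multiplier) is the real number satisfying $$\sum_{i\in\mathcal I(\mathbf X)}\frac{S_i(\mathbf X)D\ln 2}{B\left(W\!\left(\frac{\lambda^\star(\mathbf X,\mathbf H)H_{i,\min}(\mathbf X,\mathbf H)}{n_0e}-\frac1e\right)+1\right)}=1 .$$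
   Context: There are $K\ge 1$ users, $\mathcal K=\{1,\ldots,K\}$. $\mathcal X=\{(n_h,n_v): n_h=1,\ldots,N_h,\ n_v=1,\ldots,N_v\}$ is the finite set of viewing directions; $\mathbf X=(\mathbf X_k)_{k\in\mathcal K}\in\mathcal X^K$ is the viewing direction state. $\mathcal H$ is a finite nonempty set of positive reals (possible channel powers) and $\mathbf H=(H_k)_{k\in\mathcal K}\in\mathcal H^K$ is the channel state. $(\mathbf X,\mathbf H)$ is random with an arbitrary distribution on $\mathcal X^K\times\mathcal H^K$ (no independence is assumed). For each $\mathbf X$ and $k$, $\Phi_k(\mathbf X)$ is the finite nonempty set of tiles that must be transmitted to user $k$, and $\Phi(\mathbf X)=\bigcup_{k\in\mathcal K}\Phi_k(\mathbf X)$. $\Phi(\mathbf X)$ is partitioned into $I(\mathbf X)$ disjoint nonempty sets $\mathcal S_i(\mathbf X)$, $i\in\mathcal I(\mathbf X)=\{1,\ldots,I(\mathbf X)\}$, different sets being needed by different groups of users: $\mathcal K_i(\mathbf X)\subseteq\mathcal K$ (nonempty) is the set of users that need the tiles in $\mathcal S_i(\mathbf X)$, and $S_i(\mathbf X)\ge 1$ is the number of tiles in $\mathcal S_i(\mathbf X)$. $B>0$ is the bandwidth, $T>0$ the frame duration, $n_0>0$ the noise power, $0<D_1<\cdots<D_L$ the encoding rates of the $L$ quality levels, and $D$ the encoding rate of each tile. $t_i(\mathbf X,\mathbf H)$ and $p_i(\mathbf X,\mathbf H)$ are the transmission time and power for the tiles in $\mathcal S_i(\mathbf X)$. $H_{i,\min}(\mathbf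 X,\mathbf H)=\min_{k\in\mathcal K_i(\mathbf X)}H_k$. $W(\cdot)$ is the Lambert function, i.e. the principal branch: for $z\ge -1/e$, $W(z)\ge -1$ and $W(z)e^{W(z)}=z$. $e$ is the base of the natural logarithm. *)

(* Defs.v *)
From HB Require Import structures.
From mathcomp Require Import all_boot all_order all_algebra finmap.
From mathcomp Require Import all_classical all_reals all_analysis.
From mathcomp Require Import ring.
Import Order.TTheory GRing.Theory Num.Theory.
Import numFieldNormedType.Exports.

Set Implicit Arguments.
Unset Strict Implicit.
Unset Printing Implicit Defensive.

Local Open Scope ring_scope.

Section Lambert.
Context {R : realType}.
Implicit Types z w : R.

Definition log2 z : R := ln z / ln 2.

(* Principal branch; [lambertWP] and [lambertW_uniq] show that it is characterised
   by its defining property on [-1/e, +oo[.  The value 0 below -1/e is junk. *)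
Definition lambertW z : R :=
  xget 0 [set w : R | -1 <= w /\ w * expR w = z]%classic.

Lemma mul_expR_lt w1 w2 : -1 <= w1 -> w1 < w2 -> w1 * expR w1 < w2 * expR w2.
Proof.
move=> w1N1 w12.
have [w2_ge0|w2_lt0] := leP 0 w2.
  have e1 : 0 < expR w1 := expR_gt0 _.
  have e12 : expR w1 <= expR w2 by rewrite ler_expR ltW.
  apply: (@lt_le_trans _ _ (w2 * expR w1)); first by rewrite ltr_pM2r.
  by rewrite ler_wpM2l.
have -> : expR w1 = expR w2 * expR (w1 - w2).
  by rewrite -expRD addrC subrK.
rewrite mulrCA mulrC ltr_pM2r ?expR_gt0//.
have d0 : w1 - w2 != 0 by rewrite subr_eq0 lt_eqF.
have w1_lt0 : w1 < 0 := lt_trans w12 w2_lt0.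
apply: (@lt_le_trans _ _ (w1 * (1 + (w1 - w2)))).
  by rewrite ltr_nM2l// expR_gt1Dx.
rewrite -subr_ge0.
have -> : w2 - w1 * (1 + (w1 - w2)) = (w2 - w1) * (1 + w1).
  by ring.
by rewrite mulr_ge0 ?subr_ge0 ?(ltW w12)// addrC -lerBlDr sub0r.
Qed.

Lemma lambertWP z : - (expR 1)^-1 <= z ->
  -1 <= lambertW z /\ lambertW z * expR (lambertW z) = z.
Proof.
move=> zge.
pose f (w : R) := w * expR w.
have cf : ({within `[-1, `|z|], continuous f})%classic.
  apply: continuous_subspaceT => w.
  by apply: cvgM; [exact: cvg_id|exact: continuous_expR].
have le1 : -1 <= `|z| :> R by rewrite (le_trans (lerN10 _)).
have fN1 : f (-1) <= z by rewrite /f mulN1r expRN.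
have fz : z <= f `|z|.
  rewrite (le_trans (ler_norm z))// /f ler_peMr// -expR0 ler_expR//.
have [|w] := IVT (v := z) le1 cf.
  by rewrite ge_min fN1 le_max fz orbT.
rewrite in_itv/= => /andP[wN1 _] fw.
by apply: (@xgetI R 0 [set w : R | -1 <= w /\ w * expR w = z]%classic w).
Qed.

Lemma lambertW_uniq z w : -1 <= w -> w * expR w = z -> lambertW z = w.
Proof.
move=> wN1 wz; apply: xget_unique => // v [vN1 vz].
have [vw|wv|//] := ltgtP v w.
- by have := mul_expR_lt vN1 vw; rewrite vz wz ltxx.
- by have := mul_expR_lt wN1 wv; rewrite vz wz ltxx.
Qed.

End Lambert.

(* [Phi k] is the set of tiles needed by user [k]; [S i] are the [n] groups of tiles
   and [U i] the sets of users they are intended for. *)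
Definition tile_grouping (K : nat) (tile : finType) (Phi : 'I_K -> {set tile})
    (n : nat) (S : 'I_n -> {set tile}) (U : 'I_n -> {set 'I_K}) : Prop :=
  [/\ (forall i, S i != finset.set0 /\ U i != finset.set0),
      (forall i j, i != j -> [disjoint S i & S j]),
      (\bigcup_(i < n) S i)%SET = (\bigcup_(k < K) Phi k)%SET,
      (forall i k a, a \in S i -> (k \in U i) = (a \in Phi k))
    & injective U].

(* Directions are pairs of indices starting at 0 instead of 1. *)
Definition view_state (K Nh Nv : nat) := {ffun 'I_K -> 'I_Nh * 'I_Nv}.

Definition channel_state (R : realType) (K : nat) (Hs : {fset R}) :=
  {ffun 'I_K -> Hs}.

Section EnergyMinimization.
Context {R : realType} {K Nh Nv : nat} {Hs : {fset R}} {tile : finType}.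
Local Notation XK := (view_state K Nh Nv).
Local Notation HK := (channel_state K Hs).
Context {I : XK -> nat}.

(* Families indexed by (X, H, i) with i ranging over the I(X) groups of state X. *)
Definition allocation := forall (x : XK) (h : HK), 'I_(I x) -> R.

Context (S : forall x : XK, 'I_(I x) -> {set tile})
        (U : forall x : XK, 'I_(I x) -> {set 'I_K}).
Arguments S : clear implicits.
Arguments U : clear implicits.

Definition feasible (B T n0 D : R) (t p : allocation) : Prop :=
  forall (x : XK) (h : HK),
    [/\ (forall i, 0 <= p x h i),
        (forall i, 0 <= t x h i),
        \sum_(i < I x) t x h i <= T
      & (forall (i : 'I_(I x)) (k : 'I_K), k \in U x i ->
           t x h i * B * log2 (1 + p x h i * fsval (h k) / n0)
             >= #|S x i|%:R * D * T)].

Definition average_energy d (Omega : measurableType d) (P : probability Omega R)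
    (XH : Omega -> XK * HK) (t p : allocation) : R :=
  \sum_(xh : XK * HK)
    fine (P (XH @^-1` [set xh])%classic) *
    \sum_(i < I xh.1) t xh.1 xh.2 i * p xh.1 xh.2 i.

Definition optimal d (Omega : measurableType d) (P : probability Omega R)
    (XH : Omega -> XK * HK) (B T n0 D : R) (t p : allocation) : Prop :=
  feasible B T n0 D t p /\
  forall t' p' : allocation, feasible B T n0 D t' p' ->
    average_energy P XH t p <= average_energy P XH t' p'.

(* The value 0 is junk: [U x i] is nonempty for a [tile_grouping]. *)
Definition Hmin (x : XK) (h : HK) (i : 'I_(I x)) : R :=
  if [pick k in U x i] is Some k0
  then fsval (h [arg min_(k < k0 in U x i) fsval (h k)]%O)
  else 0.

Lemma HminP (x : XK) (h : HK) (i : 'I_(I x)) : U x i != finset.set0 ->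
  exists2 k, k \in U x i &
    Hmin h i = fsval (h k) /\
    forall j, j \in U x i -> fsval (h k) <= fsval (h j).
Proof.
rewrite /Hmin => /set0Pn[k kU]; case: pickP => [k0 k0U|/(_ k)]; last by rewrite kU.
by case: arg_minP => // m mU mle; exists m.
Qed.

Definition Wval (n0 lam : R) (x : XK) (h : HK) (i : 'I_(I x)) : R :=
  lambertW (lam * Hmin h i / (n0 * expR 1) - (expR 1)^-1).

Definition is_multiplier (B n0 D : R) (x : XK) (h : HK) (lam : R) : Prop :=
  0 < lam /\
  \sum_(i < I x) #|S x i|%:R * D * ln 2 / (B * (Wval n0 lam h i + 1)) = 1.

Definition tstar (B T n0 D : R) (lam : XK -> HK -> R) : allocation :=
  fun x h i =>
    #|S x i|%:R * D * T * ln 2 / (B * (Wval n0 (lam x h) h i + 1)).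

Definition pstar (n0 : R) (lam : XK -> HK -> R) : allocation :=
  fun x h i =>
    n0 * (expR (Wval n0 (lam x h) h i + 1) - 1) / Hmin h i.

End EnergyMinimization.

(* Main.v *)
(* The problem decouples over the states (x, h), and in each of them only the
   weakest user of a group matters, with gain g_i = H_{i,min} / n0.  A group has to
   receive c_i T nats with c_i = S_i D ln 2 / B.  For a multiplier lambda on the
   total time, convexity of exp gives
     g t (p + lambda) >= e^w t ln (1 + p g),  where  (w - 1) e^w + 1 = lambda g,
   that is w = W((lambda g - 1) / e) + 1, with equality when ln (1 + p g) = w.
   Summing over the groups yields optimality as soon as the times c_i T / w_i add
   up to T.  As w_i is a continuous increasing function of lambda, sum_i c_i / w_i
   is continuous and decreasing, and takes the value 1 exactly once. *)
Require Import Defs.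
From mathcomp Require Import all_boot all_order all_algebra finmap.
From mathcomp Require Import all_classical all_reals all_analysis.
From mathcomp Require Import ring lra.
Import Order.TTheory GRing.Theory Num.Theory.
Import numFieldNormedType.Exports.
Local Open Scope ring_scope.

(** * Rates, prices and the Lambert function *)

Section Price.
Context {R : realType}.
Implicit Types m w u : R.

(* Sending [c] nats takes time [c / w] at rate [w = ln (1 + p g)], so [price w] is
   [g] times the marginal energy saved per unit of extra time at that rate;
   [nats_at m] is the rate whose price is [m]. *)
Definition price w : R := (w - 1) * expR w + 1.

Definition nats_at m : R := lambertW ((m - 1) / expR 1) + 1.

Lemma price0 : price 0 = 0.
Proof. by rewrite /price expR0; ring. Qed.

Lemma priceE w : price w = (w - 1) * expR (w - 1) * expR 1 + 1.
Proof. by rewrite -mulrA -expRD subrK. Qed.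

Lemma price_lt {w1 w2} : 0 <= w1 -> w1 < w2 -> price w1 < price w2.
Proof.
move=> w1_ge0 w12; rewrite !priceE ltrD2r ltr_pM2r ?expR_gt0//.
by apply: mul_expR_lt; lra.
Qed.

Lemma price_gt0 w : 0 < w -> 0 < price w.
Proof. by move=> w_gt0; rewrite -price0 price_lt. Qed.

Lemma price_le w1 w2 : 0 <= w1 -> w1 <= w2 -> price w1 <= price w2.
Proof.
by move=> w1_ge0; rewrite le_eqVlt => /predU1P[->//|/(price_lt w1_ge0)/ltW].
Qed.

(** For [m >= 0] the argument [(m - 1) / e] is at least [-1/e], so it lies in the domain of the
    principal branch. *)
Lemma nats_atP m : 0 <= m -> 0 <= nats_at m /\ price (nats_at m) = m.
Proof.
move=> m_ge0; rewrite /nats_at priceE addrK.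
have e_gt0 : 0 < expR 1 :> R by exact: expR_gt0.
have [|W_ge ->] := @lambertWP R ((m - 1) / expR 1).
  by rewrite mulrBl mul1r lerDr divr_ge0// ltW.
by split; [lra|rewrite divfK ?gt_eqF// subrK].
Qed.

Lemma priceK w : 0 <= w -> nats_at (price w) = w.
Proof.
move=> w_ge0; rewrite /nats_at priceE addrK mulfK ?gt_eqF ?expR_gt0//.
by rewrite (@lambertW_uniq _ _ (w - 1))//; lra.
Qed.

Lemma nats_at_lt m1 m2 : 0 <= m1 -> m1 < m2 -> nats_at m1 < nats_at m2.
Proof.
move=> m1_ge0 m12; have [w1_ge0 w1E] := nats_atP m1 m1_ge0.
have [w2_ge0 w2E] := nats_atP m2 (le_trans m1_ge0 (ltW m12)).
rewrite ltNge; apply: contraTN m12 => /(price_le _ _ w2_ge0).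
by rewrite w1E w2E leNgt.
Qed.

Lemma nats_at_le m1 m2 : 0 <= m1 -> m1 <= m2 -> nats_at m1 <= nats_at m2.
Proof.
by move=> m1_ge0; rewrite le_eqVlt => /predU1P[->//|/(nats_at_lt _ _ m1_ge0)/ltW].
Qed.

Lemma nats_at_gt0 m : 0 < m -> 0 < nats_at m.
Proof.
by move=> m_gt0; rewrite -{1}(priceK 0)// price0 nats_at_lt.
Qed.

Lemma continuous_price : continuous price.
Proof.
move=> w; apply: cvgD; last exact: cvg_cst.
apply: cvgM; last exact: continuous_expR.
by apply: cvgB; [exact: cvg_id|exact: cvg_cst].
Qed.

(** A local left inverse of a continuous function is continuous; positivity of [m] keeps nearby
    rates positive, where [priceK] applies. *)
Lemma continuous_nats_at m : 0 < m -> {for m, continuous nats_at}.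
Proof.
move=> m_gt0; have [_ <-] := nats_atP m (ltW m_gt0).
have w_gt0 := nats_at_gt0 m m_gt0.
apply: (nbhs_singleton (near_can_continuous _ _)); last first.
  by near=> w; exact: continuous_price.
near=> w; apply: priceK; apply: ltW; near: w; exact: lt_nbhsr.
Unshelve. all: by end_near. Qed.

(* The tangent at [w] of the convex function [expR - 1 + price w] passes through
   the origin. *)
Lemma lagrangian_ge w u : expR w * u <= expR u - 1 + price w.
Proof.
have := @expR_ge1Dx R (u - w); have := expR_gt0 w.
have -> : expR u = expR w * expR (u - w) by rewrite -expRD subrKC.
rewrite /price => w0 uw.
have := ler_wpM2l (ltW w0) uw; lra.
Qed.

End Price.

(** * Existence and uniqueness of the multiplier, and weak duality *)

Section Multiplier.
Context {R : realType} {n : nat} (c g : 'I_n -> R).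
Hypotheses (n_gt0 : (0 < n)%N) (c_gt0 : forall i, 0 < c i)
  (g_gt0 : forall i, 0 < g i).

(** This is the fraction of the frame that all groups occupy together when time is priced at
    [lam]. *)
Let load lam := \sum_i c i / nats_at (lam * g i).

Lemma load_dec lam1 lam2 : 0 < lam1 -> lam1 < lam2 -> load lam2 < load lam1.
Proof.
move=> l1 l12; apply: ltr_sum => [|i _].
  by apply/hasP; exists (Ordinal n_gt0); rewrite ?mem_index_enum.
have m1 : 0 < lam1 * g i by rewrite mulr_gt0.
have m12 : lam1 * g i < lam2 * g i by rewrite ltr_pM2r.
rewrite ltr_pM2l// ltf_pV2 ?posrE ?nats_at_gt0//; last exact: lt_trans m12.
by rewrite nats_at_lt// ltW.
Qed.

Lemma load_continuous lam : 0 < lam -> {for lam, continuous load}.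
Proof.
move=> l0; apply: cvg_big => [|i _]; first exact: add_continuous.
apply: cvgM; first exact: cvg_cst.
have m0 : 0 < lam * g i by rewrite mulr_gt0.
apply: cvgV; first by rewrite gt_eqF ?nats_at_gt0.
apply: (@cvg_comp _ _ _ (fun l : R => l * g i) nats_at _ (nbhs (lam * g i))).
  by apply: cvgM; [exact: cvg_id|exact: cvg_cst].
exact: continuous_nats_at.
Qed.

Lemma multiplier_exists : exists2 lam, 0 < lam & load lam = 1.
Proof.
pose i0 := Ordinal n_gt0; pose C := \sum_i c i.
have leC i : c i <= C.
  by rewrite /C (bigD1 i)//= lerDl sumr_ge0// => j _; exact: ltW.
have C_gt0 : 0 < C by exact: lt_le_trans (leC i0).
(* At [lo] the group [i0] has rate [c i0] and alone fills the frame. At [hi], where the sum stands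
   in for a maximum, every rate is at least [C], so the load is at most [\sum_i c i / C = 1]. *)
pose lo := price (c i0) / g i0; pose hi := \sum_i price C / g i.
have lehi i : price C / g i <= hi.
  rewrite /hi (bigD1 i)//= lerDl sumr_ge0// => j _.
  by rewrite divr_ge0 ?ltW ?price_gt0.
have lo_gt0 : 0 < lo by rewrite divr_gt0 ?price_gt0.
have lohi : lo <= hi.
  by apply: le_trans (lehi i0); rewrite ler_pM2r ?invr_gt0// price_le// ltW.
have cont : {within `[lo, hi], continuous load}%classic.
  apply: continuous_in_subspaceT => l; rewrite inE/= in_itv/= => /andP[lol _].
  by apply: load_continuous; exact: lt_le_trans lol.
have load_lo : 1 <= load lo.
  rewrite /load (bigD1 i0)//= {1}/lo divfK ?gt_eqF// priceK; last exact: ltW.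
  rewrite divff ?gt_eqF//.
  rewrite lerDl sumr_ge0// => i _.
  by rewrite divr_ge0// ltW// nats_at_gt0// mulr_gt0.
have load_hi : load hi <= 1.
  have -> : 1 = \sum_i c i / C by rewrite -mulr_suml divff// gt_eqF.
  apply: ler_sum => i _; rewrite ler_pM2l// lef_pV2 ?posrE//; last first.
    by rewrite nats_at_gt0// mulr_gt0// (lt_le_trans lo_gt0).
  rewrite -[leLHS](priceK _ (ltW C_gt0)); apply: nats_at_le.
    by rewrite ltW// price_gt0.
  by rewrite -ler_pdivrMr.
have [|lam] := IVT (v := 1) lohi cont.
  by rewrite ge_min load_hi orbT le_max load_lo.
by rewrite in_itv/= => /andP[lol _] lE; exists lam => //; exact: lt_le_trans lol.
Qed.

Lemma multiplier_unique lam1 lam2 :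
  0 < lam1 -> 0 < lam2 -> load lam1 = 1 -> load lam2 = 1 -> lam1 = lam2.
Proof.
move=> l1 l2 E1 E2; have [l12|l21|//] := ltgtP lam1 lam2.
- by have := load_dec _ _ l1 l12; rewrite E1 E2 ltxx.
- by have := load_dec _ _ l2 l21; rewrite E1 E2 ltxx.
Qed.

(* Weak duality; the left-hand side is the energy spent at the rates
   [nats_at (lam * g i)]. *)
Lemma energy_ge T lam (t p : 'I_n -> R) : 0 < lam -> load lam = 1 ->
  (forall i, 0 <= t i) -> \sum_i t i <= T ->
  (forall i, 0 <= p i) ->
  (forall i, c i * T <= t i * ln (1 + p i * g i)) ->
  \sum_i (c i * T / nats_at (lam * g i)) *
         ((expR (nats_at (lam * g i)) - 1) / g i) <= \sum_i t i * p i.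
Proof.
move=> l0 loadE t0 tT p0 rate.
pose w i := nats_at (lam * g i).
have m0 i : 0 < lam * g i by rewrite mulr_gt0.
have w0 i : 0 < w i by exact: nats_at_gt0.
have wE i : price (w i) = lam * g i by have [] := nats_atP _ (ltW (m0 i)).
(* The price equation eliminates [lam]; the subtracted terms then add up to [lam * T] because the
   load is 1. *)
have lhsE i : c i * T / w i * ((expR (w i) - 1) / g i) =
    expR (w i) * (c i * T) / g i - lam * T * (c i / w i).
  have := wE i; rewrite /price => {}wE.
  have gN0 : g i != 0 by rewrite gt_eqF.
  have wN0 : w i != 0 by rewrite gt_eqF.
  have -> : lam = ((w i - 1) * expR (w i) + 1) / g i by rewrite wE mulfK.
  by field; rewrite wN0.
under eq_bigr do rewrite lhsE.
rewrite sumrB -mulr_sumr -/(load lam) loadE mulr1 lerBlDr.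
(* The time budget bounds [lam * \sum_i t i] by [lam * T], which decouples the groups. *)
apply: (@le_trans _ _ (\sum_i (t i * p i + lam * t i))); last first.
  by rewrite big_split/= lerD2l -mulr_sumr ler_pM2l.
apply: ler_sum => i _; rewrite ler_pdivrMr//.
have u1 : 0 < 1 + p i * g i by have := mulr_ge0 (p0 i) (ltW (g_gt0 i)); lra.
(* With [u = ln (1 + p g)], the chain is [e^w c T <= e^w t u <= t (p g + lam g)]. *)
have := lagrangian_ge (w i) (ln (1 + p i * g i)).
rewrite lnK ?posrE// wE => /(ler_wpM2l (t0 i)) lag.
have := ler_wpM2l (ltW (expR_gt0 (w i))) (rate i); lra.
Qed.

End Multiplier.

(** * Back to the tile groups and channel states *)

Lemma Wval_nats_at {R : realType} {K Nh Nv : nat} {Hs : {fset R}}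
    {I : view_state K Nh Nv -> nat}
    (U : forall x : view_state K Nh Nv, 'I_(I x) -> {set 'I_K})
    (n0 lam : R) (x : view_state K Nh Nv) (h : channel_state K Hs) (i : 'I_(I x)) :
  n0 != 0 -> Wval U n0 lam h i + 1 = nats_at (lam * (Hmin U h i / n0)).
Proof.
move=> n0N0; rewrite /Wval /nats_at; congr (lambertW _ + 1).
by field; rewrite n0N0 gt_eqF// expR_gt0.
Qed.

(** Any tile needed by a user lies in some group. Without groups the load would be 0 and no
    multiplier could exist. *)
Lemma tile_grouping_gt0 (K : nat) (tile : finType) (Phi : 'I_K -> {set tile})
    (n : nat) (S : 'I_n -> {set tile}) (U : 'I_n -> {set 'I_K}) :
  (0 < K)%N -> (forall k, Phi k != finset.set0) -> tile_grouping Phi S U ->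
  (0 < n)%N.
Proof.
move=> K_gt0 /(_ (Ordinal K_gt0))/set0Pn[a aPhi] [_ _ /setP/(_ a) + _ _].
have -> : a \in (\bigcup_(k < K) Phi k)%SET.
  by apply/bigcupP; exists (Ordinal K_gt0).
by move=> /bigcupP[i _ _]; exact: leq_ltn_trans (ltn_ord i).
Qed.

Theorem lemma2
  (R : realType) (K Nh Nv : nat) (Hs : {fset R})
  (d : measure_display) (Omega : measurableType d) (P : probability Omega R)
  (XH : Omega -> view_state K Nh Nv * channel_state K Hs)
  (tile : finType)
  (Phi : view_state K Nh Nv -> 'I_K -> {set tile})
  (I : view_state K Nh Nv -> nat)
  (S : forall x : view_state K Nh Nv, 'I_(I x) -> {set tile})
  (U : forall x : view_state K Nh Nv, 'I_(I x) -> {set 'I_K})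
  (B T n0 : R) (L : nat) (rate : 'I_L -> R) (D : R) :
  (0 < K)%N ->
  Hs != fset0 ->
  (forall r : R, r \in Hs -> 0 < r) ->
  (forall xh, measurable (XH @^-1` [set xh])%classic) ->
  (forall x k, Phi x k != finset.set0) ->
  (forall x, tile_grouping (Phi x) (S x) (U x)) ->
  0 < B -> 0 < T -> 0 < n0 ->
  (forall l : 'I_L, 0 < rate l) ->
  (forall l m : 'I_L, (l < m)%N -> rate l < rate m) ->
  (exists l : 'I_L, D = rate l) ->
  (forall (x : view_state K Nh Nv) (h : channel_state K Hs),
     exists! lam : R, is_multiplier S U B n0 D x h lam) /\
  (forall lam : view_state K Nh Nv -> channel_state K Hs -> R,
     (forall x h, is_multiplier S U B n0 D x h (lam x h)) ->
     optimal S U P XH B T n0 D (tstar S U B T n0 D lam) (pstar U n0 lam)).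
Proof.
move=> K_gt0 _ Hs_gt0 _ Phi0 grp B0 T0 n00 rate0 _ [l Dl].
have D0 : 0 < D by rewrite Dl.
have ln20 : 0 < ln 2 :> R by rewrite ln_gt0// ltr1n.
have n0N0 : n0 != 0 by rewrite gt_eqF.
have n_gt0 x : (0 < I x)%N := tile_grouping_gt0 _ _ _ _ _ _ K_gt0 (Phi0 x) (grp x).
pose c x (i : 'I_(I x)) : R := #|S x i|%:R * D * ln 2 / B.
pose g x (h : channel_state K Hs) (i : 'I_(I x)) : R := Hmin U h i / n0.
have c_gt0 x i : 0 < c x i.
  rewrite divr_gt0// !mulr_gt0// ltr0n card_gt0.
  by have [/(_ i)[]] := grp x.
have HminU x (h : channel_state K Hs) (i : 'I_(I x)) : exists2 k, k \in U x i &
    Hmin U h i = fsval (h k) /\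
    forall j, j \in U x i -> fsval (h k) <= fsval (h j).
  by apply: HminP; have [/(_ i)[]] := grp x.
have Hmin_gt0 x (h : channel_state K Hs) (i : 'I_(I x)) : 0 < Hmin U h i.
  by have [k _ [-> _]] := HminU x h i; exact: Hs_gt0 (fsvalP _).
have g_gt0 x h i : 0 < g x h i by rewrite divr_gt0.
have multE x (h : channel_state K Hs) lam : is_multiplier S U B n0 D x h lam <->
    0 < lam /\ \sum_i c x i / nats_at (lam * g x h i) = 1.
  rewrite /is_multiplier (eq_bigr (fun i => c x i / nats_at (lam * g x h i)))//.
  by move=> i _; rewrite Wval_nats_at// invfM [LHS]mulrA.
split=> [x h|lam lamP].
  have [lam l0 lE] := multiplier_exists _ _ (n_gt0 x) (c_gt0 x) (g_gt0 x h).
  exists lam; split=> [|lam' /multE[l0' lE']]; first exact/multE.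
  exact: (multiplier_unique _ _ (n_gt0 x) (c_gt0 x) (g_gt0 x h)).
have tE x (h : channel_state K Hs) (i : 'I_(I x)) : tstar S U B T n0 D lam h i =
    c x i * T / nats_at (lam x h * g x h i).
  rewrite /tstar Wval_nats_at// invfM [LHS]mulrA; congr (_ / _).
  by rewrite /c; ring.
have pE x (h : channel_state K Hs) (i : 'I_(I x)) : pstar U n0 lam h i =
    (expR (nats_at (lam x h * g x h i)) - 1) / g x h i.
  rewrite /pstar Wval_nats_at// /g invfM invrK; ring.
have w_gt0 x (h : channel_state K Hs) (i : 'I_(I x)) : 0 < nats_at (lam x h * g x h i).
  by have /multE[l0 _] := lamP x h; rewrite nats_at_gt0// mulr_gt0.
split=> [x h|t p tp].
  have p_ge0 (i : 'I_(I x)) : 0 <= pstar U n0 lam h i.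
    by rewrite pE divr_ge0 ?subr_ge0 ?ltW// expR_gt1.
  have t_ge0 (i : 'I_(I x)) : 0 <= tstar S U B T n0 D lam h i.
    by rewrite tE ltW// divr_gt0// mulr_gt0.
  (* The multiplier equation makes the total time exactly [T]. *)
  split=> // [|i k kU].
    under eq_bigr do rewrite tE mulrAC.
    by have /multE[_ E] := lamP x h; rewrite -mulr_suml E mul1r.
  have [k0 _ [HE /(_ k kU) le_k]] := HminU x h i.
  have logE : expR (nats_at (lam x h * g x h i)) = 1 + pstar U n0 lam h i * g x h i.
    by rewrite pE divfK ?gt_eqF// subrKC.
  (* The demand is met with equality at the weakest gain, and user [k] has at least that gain. *)
  apply: (@le_trans _ _ (tstar S U B T n0 D lam h i * B *
      (nats_at (lam x h * g x h i) / ln 2))).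
    rewrite tE le_eqVlt; apply/orP; left; apply/eqP; rewrite /c.
    by field; rewrite !gt_eqF.
  apply: ler_wpM2l; first by rewrite mulr_ge0// ltW.
  rewrite /log2 ler_pM2r ?invr_gt0//.
  rewrite -[leLHS]expRK logE ler_ln ?posrE.
  - by rewrite lerD2l -mulrA ler_wpM2l// ler_pM2r ?invr_gt0// HE.
  - by rewrite -logE expR_gt0.
  - rewrite ltr_wpDr// divr_ge0 ?(ltW n00)//.
    by rewrite mulr_ge0// ltW// Hs_gt0// fsvalP.
(* Probabilities are nonnegative weights, so it suffices to compare the energies in each state. *)
apply: ler_sum => -[x h] _ /=; rewrite ler_wpM2l ?fine_ge0//.
have [p0 t0 tT rate_ge] := tp x h.
have /multE[l0 lE] := lamP x h.
under eq_bigr do rewrite tE pE.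
apply: (energy_ge _ _ (g_gt0 x h)) => // i.
have [k kU [HE _]] := HminU x h i.
have bln : 0 <= ln 2 / B by rewrite divr_ge0 ?ltW.
(* The factor [ln 2 / B] turns the weakest user's constraint from bits into nats. *)
have := ler_wpM2r bln (rate_ge i k kU); rewrite -HE /log2 -[_ / n0]mulrA.
congr (_ <= _); first by rewrite /c; ring.
by field; rewrite !gt_eqF.
Qed.
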